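(* For every cubic bridgeless graph $G$, $m_2(G)\ge \tfrac{5}{12}\, m_4(G)+\tfrac{7}{36}$.
   Context: A cubic bridgeless graph is a graph in which every vertex has degree 3 and each connected component is 2-edge-connected. A perfect matching of $G$ is a set of edges such that every vertex is incident to exactly one of them. For a cubic bridgeless graph $G$ and a positive integer $t$, $m_t(G)$ denotes the maximum, over all choices of $t$ perfect matchings $M_1,\dots,M_t$ of $G$, of $|M_1\cup\dots\cup M_t|/|E(G)|$. *)

(* Defs.v *)
From HB Require Import structures.
From mathcomp Require Import all_boot all_order all_algebra.

Set Implicit Arguments.
Unset Strict Implicit.
Unset Printing Implicit Defensive.

Import Order.TTheory GRing.Theory Num.Theory.

(* Finite graphs in which parallel edges and loops are allowed.  Each edge
   stores its two ends in an arbitrary order; everything below is symmetric in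
   [src] and [tgt]. *)
Record mgraph := MGraph {
  vertex : finType;
  edge : finType;
  src : edge -> vertex;
  tgt : edge -> vertex }.

Section Graph.

Variable G : mgraph.
Implicit Types (e : edge G) (v x y : vertex G) (F M : {set edge G})
  (C : {set vertex G}).

Definition incident e v : bool := (src e == v) || (tgt e == v).

(* A loop contributes 2. *)
Definition degree v : nat :=
  #|[set e : edge G | src e == v]| + #|[set e : edge G | tgt e == v]|.

Definition cubic : Prop := forall v, degree v = 3.

Definition adj F : rel (vertex G) := fun x y =>
  [exists e in F, ((src e == x) && (tgt e == y))
               || ((src e == y) && (tgt e == x))].

Definition component x : {set vertex G} := [set y | connect (adj setT) x y].

(* Meant for a connected component C of G: a walk of G starting in C never
   leaves C, so it does not matter that edges outside C are kept. *)
Definition edge_connected (k : nat) C : Prop :=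
  1 < #|C| /\
  forall F, #|F| < k -> {in C &, forall x y, connect (adj (~: F)) x y}.

Definition bridgeless : Prop := forall x, edge_connected 2 (component x).

Definition perfect_matching M : bool :=
  [forall v, #|[set e in M | incident e v]| == 1].

(* The largest fraction of the edges covered by t perfect matchings, which need
   not be distinct.  As \max over an empty range is 0, m t = 0 when G has no
   perfect matching. *)
Definition m (t : nat) : rat :=
  ((\max_(M : {ffun 'I_t -> {set edge G}} | [forall i, perfect_matching (M i)])
      #|\bigcup_(i < t) M i|)%N%:R / #|edge G|%:R)%R.

End Graph.

Arguments cubic : clear implicits.
Arguments bridgeless : clear implicits.
Arguments m : clear implicits.

(* Main.v *)
(* Four perfect matchings attaining m_4 cover the three edges at a vertex with
   multiplicities (2,1,1), (2,2,0), (3,1,0) or (4,0,0).  Summing the sizes of the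
   six pairwise unions, the bound on their average reduces to an inequality in
   these four cases, tight for (2,1,1) and (4,0,0).  That perfect matchings exist
   at all is Petersen's theorem; it is derived from Tutte's theorem, which is
   proved after Anderson, from Hall's theorem applied to a largest set S for which
   Tutte's condition is tight. *)
Require Import Defs.
From HB Require Import structures.
From mathcomp Require Import all_boot all_order all_algebra.
From mathcomp Require Import zify lra.

Set Implicit Arguments.
Unset Strict Implicit.
Unset Printing Implicit Defensive.

Import Order.TTheory GRing.Theory Num.Theory.

(** * Hall's marriage theorem *)

(** Induction on [#|X|]. If some nonempty proper [Y] has no surplus of neighbours, [Y] and [X :\: Y]
    are matched separately, the latter avoiding the neighbours of [Y]. Otherwise any neighbour of
    any one element can be spent on it. *)
Lemma hall (A B : finType) (b0 : B) (F : A -> {set B}) (X : {set A}) :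
  (forall Y : {set A}, Y \subset X -> #|Y| <= #|\bigcup_(a in Y) F a|) ->
  exists f : A -> B, {in X, forall a, f a \in F a} /\ {in X &, injective f}.
Proof.
have [n] := ubnP #|X|; elim: n => // n IHn in F X *; rewrite ltnS => leXn hallX.
have [->|[a aX]] := set_0Vmem X.
  by exists (fun _ => b0); split=> x; rewrite inE.
have [|] := boolP [exists Y : {set A}, [&& Y \proper X, Y != set0
    & #|\bigcup_(a in Y) F a| <= #|Y|]].
  case/existsP=> Y /and3P[YX Y0 leNY].
  have sYX := proper_sub YX.
  have ltYn : #|Y| < n by apply: leq_trans (proper_card YX) leXn.
  have [|f [fF finj]] := IHn F Y ltYn.
    by move=> Z ZY; apply: hallX; apply: subset_trans sYX.
  set N := \bigcup_(a in Y) F a in leNY.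
  have ltXYn : #|X :\: Y| < n.
    by move: Y0; rewrite -card_gt0 cardsDS // => Y0; have := subset_leq_card sYX; lia.
  have [|g [gF ginj]] := IHn (fun a => F a :\: N) _ ltXYn.
    move=> Z ZXY.
    have dZY : [disjoint Z & Y].
      by move: ZXY; rewrite subsetD => /andP[].
    (* The union with [Y] has at least [#|Z| + #|Y|] neighbours, of which the set [N] accounts for
       at most [#|Y|]. *)
    have := hallX (Z :|: Y); rewrite subUset (subset_trans ZXY (subsetDl _ _)) sYX.
    move=> /(_ isT); rewrite cardsU (disjoint_setI0 dZY) cards0 subn0.
    rewrite bigcup_setU /=.
    have -> : \bigcup_(a0 in Z) F a0 :|: \bigcup_(a0 in Y) F a0
       = (\bigcup_(a0 in Z) (F a0 :\: N)) :|: N.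
      apply/setP=> b; rewrite !inE; have [bN|bN] := boolP (b \in N).
        by rewrite !orbT.
      rewrite !orbF; apply/bigcupP/bigcupP => -[z zZ bz]; exists z => //.
        by rewrite inE bN.
      by move: bz; rewrite inE => /andP[].
    by rewrite cardsU; lia.
  have memN x : x \in Y -> f x \in N by move=> xY; apply/bigcupP; exists x; rewrite ?fF.
  have notN x : x \in X -> x \notin Y -> g x \notin N.
    by move=> xX xY; have := gF x; rewrite !inE xX xY => /(_ isT) /andP[].
  exists (fun x => if x \in Y then f x else g x); split=> [x xX|x y xX yX].
    case: ifPn => [|xY]; first exact: fF.
    by have := gF x; rewrite !inE xX xY => /(_ isT) /andP[].
  case: ifPn => xY; case: ifPn => yY; first exact: finj.
  - by move=> E; have := notN y yX yY; rewrite -E memN.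
  - by move=> E; have := notN x xX xY; rewrite E memN.
  - by apply: ginj; rewrite inE ?xY ?yY.
rewrite negb_exists => /forallP noY.
have [b bF] : exists b, b \in F a.
  apply/set0Pn; have := hallX [set a]; rewrite sub1set big_set1 cards1 => /(_ aX).
  by rewrite card_gt0.
have ltXn : #|X :\ a| < n by move: leXn; rewrite (cardsD1 a X) aX.
have [|f [fF finj]] := IHn (fun x => F x :\ b) _ ltXn.
  (* A nonempty [Z] missing [a] is proper in [X], so it has a neighbour to spare and can afford the
     loss of [b]. *)
  move=> Z ZX; have [->|Z0] := eqVneq Z set0; first by rewrite cards0.
  have := noY Z; rewrite Z0 /= negb_and -ltnNge.
  have -> /= : Z \proper X.
    apply: (sub_proper_trans ZX); apply/properP; split; first exact: subsetDl.
    by exists a => //; rewrite !inE eqxx.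
  have -> : \bigcup_(x in Z) (F x :\ b) = (\bigcup_(x in Z) F x) :\ b.
    apply/setP=> y; rewrite !inE; apply/bigcupP/andP => [[z zZ]|[yb /bigcupP[z zZ yz]]].
      by rewrite !inE => /andP[-> yz]; split=> //; apply/bigcupP; exists z.
    by exists z; rewrite // !inE yb.
  by rewrite (cardsD1 b (\bigcup_(x in Z) F x)); lia.
exists (fun x => if x == a then b else f x); split=> [x xX|x y xX yX].
  case: eqP => [->//|/eqP xa]; have := fF x; rewrite !inE xX xa => /(_ isT).
  by case/andP.
have neb z : z \in X -> z != a -> f z != b.
  by move=> zX za; have := fF z; rewrite !inE zX za => /(_ isT) /andP[].
case: (eqVneq x a) => [->|xa]; case: (eqVneq y a) => [->|ya] //.
- by move=> E; have := neb _ yX ya; rewrite -E eqxx.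
- by move=> E; have := neb _ xX xa; rewrite E eqxx.
- by apply: finj; rewrite !inE ?xa ?ya.
Qed.

(** * Tutte's theorem *)

Section Tutte.

Variables (T : finType) (e : rel T).
Hypothesis e_sym : symmetric e.
Implicit Types (C S U W : {set T}) (P : {set {set T}}).

(** For symmetric [e], these are the unions of connected components of the subgraph induced on
    [U]. *)
Definition closed_in U C : bool :=
  (C \subset U) && [forall x in C, forall y in U :\: C, ~~ e x y].

Definition odd_family U P : bool :=
  trivIset P && [forall C in P, odd #|C| && closed_in U C].

(* Equivalent to Tutte's condition on the induced subgraph W: the largest odd
   family in W :\: S consists of the odd components of W :\: S.  Asking only
   for closed sets avoids connectivity altogether. *)
Definition tutte_condition W : Prop :=
  forall S P, S \subset W -> odd_family (W :\: S) P -> #|P| <= #|S|.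

Definition matching_on W (mate : T -> T) : Prop := {in W, forall x,
  [/\ mate x \in W, mate (mate x) = x, mate x != x & e x (mate x)]}.

Lemma closed_inP U C :
  reflect (C \subset U /\ forall x y, x \in C -> y \in U -> y \notin C -> ~~ e x y)
          (closed_in U C).
Proof.
apply: (iffP andP) => -[CU H]; split=> //.
  by move=> x y xC yU yC; move/forall_inP/(_ x xC)/forall_inP: H; apply; rewrite inE yC.
by apply/forall_inP=> x xC; apply/forall_inP=> y; rewrite inE => /andP[yC yU]; apply: H.
Qed.

Lemma odd_familyP U P :
  reflect [/\ trivIset P, {in P, forall C, odd #|C|} & {in P, forall C, closed_in U C}]
          (odd_family U P).
Proof.
apply: (iffP andP) => [[tP /forall_inP H]|[tP H1 H2]]; split=> //.
- by move=> C /H /andP[].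
- by move=> C /H /andP[].
- by apply/forall_inP=> C CP; rewrite H1 ?H2.
Qed.

Lemma trivIset_eq P C D x : trivIset P -> C \in P -> D \in P ->
  x \in C -> x \in D -> C = D.
Proof.
by move=> tP CP DP xC xD; rewrite -(def_pblock tP CP xC); apply: def_pblock.
Qed.

Lemma odd_family_cover U P : odd_family U P -> cover P \subset U.
Proof.
case/odd_familyP=> _ _ cP; apply/bigcupsP=> C CP.
by case/closed_inP: (cP C CP).
Qed.

Lemma odd_cover U P : odd_family U P -> odd #|cover P| = odd #|P|.
Proof.
case/odd_familyP=> tP oP _; rewrite -(eqP tP).
have -> : #|P| = \sum_(C in P) 1 by rewrite sum1_card.
by elim/big_ind2: _ => // a b c d ab cd; rewrite !oddD ab cd.
Qed.

(* The complement of the family in U is closed, and odd by parity. *)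
Lemma odd_family_extend U P : odd_family U P -> odd (#|U| + #|P|) ->
  exists2 P', odd_family U P' & #|P'| = #|P|.+1.
Proof.
move=> fP oUP; have cU := odd_family_cover fP; have oc := odd_cover fP.
case/odd_familyP: (fP) => tP oP cP.
set R := U :\: cover P.
have oR : odd #|R|.
  have := cardsID (cover P) U; rewrite (setIidPr cU) -/R => E.
  by move: oUP; rewrite -E !oddD oc; case: (odd #|P|); case: (odd #|R|).
have dR : [disjoint R & cover P] by rewrite disjoint_sym disjoints_subset setCD subsetUr.
have RP : R \notin P.
  apply/negP=> RP; have : R != set0 by rewrite -card_gt0; case: #|R| oR.
  case/set0Pn=> x xR; have := disjointFr dR xR.
  by move/negP; apply; apply/bigcupP; exists R.
exists (R |: P); last by rewrite cardsU1 RP.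
apply/odd_familyP; split.
- apply: trivIsetU => //; last by rewrite /cover big_set1.
  exact: trivIset1.
- by move=> C /setU1P[->|/oP].
- move=> C /setU1P[->|/cP//]; apply/closed_inP; split; first exact: subsetDl.
  move=> x y; rewrite !inE => /andP[xc xU] yU; rewrite yU andbT negbK => /bigcupP[D DP yD].
  rewrite e_sym; case/closed_inP: (cP D DP) => _; apply=> //.
  by apply: contra xc => xD; apply/bigcupP; exists D.
Qed.

Lemma odd_family_sub U U' P : U' \subset U -> cover P \subset U' ->
  odd_family U P -> odd_family U' P.
Proof.
move=> sU cU' /odd_familyP[tP oP cP]; apply/odd_familyP; split=> // C CP.
case/closed_inP: (cP C CP) => CU H; apply/closed_inP; split.
  by apply: subset_trans cU'; apply: bigcup_sup.
by move=> x y xC yU'; apply: H => //; apply: (subsetP sU).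
Qed.

(** An edge leaving [D] inside [V] would either stay in [C] or leave [C]; each is excluded by one
    hypothesis. This lets a member of an odd family be replaced by a family inside it. *)
Lemma closed_in_trans U V C D : closed_in U C -> closed_in (C :&: V) D ->
  closed_in (U :&: V) D.
Proof.
move=> /closed_inP[CU HC] /closed_inP[]; rewrite subsetI => /andP[DC DV] HD.
apply/closed_inP; rewrite subsetI DV (subset_trans DC CU); split=> // x y xD.
rewrite inE => /andP[yU yV] yD; have [yC|yC] := boolP (y \in C).
  by apply: HD => //; rewrite inE yC.
by apply: HC => //; apply: (subsetP DC).
Qed.

(** Under Tutte's condition such an [S] is a barrier in the sense of matching theory, and [P] is a
    witness. *)
Definition tight W S P : bool :=
  [&& S \subset W, odd_family (W :\: S) P & #|P| == #|S|].

(** For odd [#|W|] the empty family would extend to one of size 1, against Tutte's condition at the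
    empty set. *)
Lemma tutte_even W : tutte_condition W -> ~~ odd #|W|.
Proof.
move=> tW; apply/negP=> oW.
have f0 : odd_family W set0.
  by apply/odd_familyP; split=> [|C|C]; rewrite ?inE // /trivIset /cover !big_set0 cards0.
have [|P fP cP] := odd_family_extend f0; first by rewrite cards0 addn0.
by have := tW set0 P (sub0set _); rewrite setD0 cP !cards0 => H; have := H fP.
Qed.

(** * Structure around a tight set of maximum size *)

Section MaximalTight.

Variables (W S : {set T}) (P : {set {set T}}).
Hypotheses (tW : tutte_condition W) (tight_SP : tight W S P).
Hypothesis max_S : forall S' P', tight W S' P' -> #|S'| <= #|S|.

(** An uncovered [x] could be moved into [S]. As [#|W|] is even and [#|P| = #|S|], parity then lets
    [P] gain a member, so that [x |: S] would be a larger tight set. *)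
Lemma max_tight_cover : cover P = W :\: S.
Proof.
case/and3P: tight_SP => SW fP /eqP cPS.
apply/eqP; rewrite eqEsubset (odd_family_cover fP); apply/subsetP => x xWS.
apply/negPn/negP=> xc; have [xS xW] := setDP xWS.
have S'W : x |: S \subset W by rewrite subUset sub1set xS SW.
have sWS : W :\: (x |: S) \subset W :\: S by apply: setDS; apply: subsetUr.
have fP' : odd_family (W :\: (x |: S)) P.
  apply: (odd_family_sub _ _ fP) => //; rewrite setDE setCU setICA -setDE.
  apply/subsetP=> y yc; rewrite !inE; have := subsetP (odd_family_cover fP) y yc.
  by rewrite inE => ->; rewrite andbT; apply: contraNneq xc => <-.
have cS' : #|x |: S| = #|S|.+1 by rewrite cardsU1 (negbTE xW).
have [|P' fP'' cP'] := odd_family_extend fP'.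
  rewrite cardsDS // cS' cPS; have := subset_leq_card S'W; have := tutte_even tW.
  by rewrite cS'; clear; lia.
suff /max_S : tight W (x |: S) P' by rewrite cS' ltnn.
by rewrite /tight S'W fP'' cP' cS' cPS /=.
Qed.

(** A violation [S'] inside [C :\ x] would give a larger tight set: add [x] and [S'] to [S], and
    replace [C] in [P] by the violating family. *)
Lemma max_tight_member C x : C \in P -> x \in C -> tutte_condition (C :\ x).
Proof.
move=> CP xC S' P0 S'C fP0; rewrite leqNgt; apply/negP=> ltP0.
case/and3P: tight_SP => SW fP /eqP cPS.
case/odd_familyP: (fP) => tP oP cP.
have CWS : C \subset W :\: S by case/closed_inP: (cP C CP).
have cCx : #|C| = #|C :\ x|.+1 by rewrite (cardsD1 x C) xC.
have oC := oP C CP.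
(* Since [C :\ x] is even, parity raises the excess from one to two: one unit pays for [x], the
   other for the loss of [C]. *)
have [P' fP' ltP'] : exists2 P', odd_family ((C :\ x) :\: S') P' & #|S'|.+1 < #|P'|.
  have [o|o] := boolP (odd (#|(C :\ x) :\: S'| + #|P0|)).
    by have [P' fP' cP'] := odd_family_extend fP0 o; exists P'; rewrite ?cP'.
  exists P0 => //; move: o; rewrite cardsDS //; have := subset_leq_card S'C.
  by move: cCx oC ltP0; clear; lia.
case/odd_familyP: (fP') => tP' oP' cP'.
set S1 := (x |: S') :|: S; set P1 := P' :|: (P :\ C).
have xS'C : x |: S' \subset C.
  by rewrite subUset sub1set xC (subset_trans S'C (subsetDl _ _)).
have S1W : S1 \subset W.
  by rewrite subUset SW andbT (subset_trans xS'C) // (subset_trans CWS) // subsetDl.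
have WS1 : W :\: S1 = (W :\: S) :&: ~: (x |: S').
  by rewrite /S1 setUC -setDDl setDE.
have CS1 : (C :\ x) :\: S' = C :&: ~: (x |: S') by rewrite setDDl setDE.
have cS1 : #|S1| = #|S'|.+1 + #|S|.
  rewrite /S1 cardsU; have -> : (x |: S') :&: S = set0.
    apply/eqP; rewrite setI_eq0; apply: (disjointWl xS'C).
    by move: CWS; rewrite subsetD => /andP[].
  rewrite cards0 subn0 cardsU1; suff -> : x \notin S' by [].
  by apply/negP=> /(subsetP S'C); rewrite !inE eqxx.
have covP' : cover P' \subset C.
  apply: (subset_trans (odd_family_cover fP')).
  by rewrite setDDl subsetDl.
have dPP : [disjoint cover P' & cover (P :\ C)].
  rewrite coverD1 //; apply: (disjointWl covP').
  by rewrite disjoint_sym disjoints_subset setDE subsetIr.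
have fP1 : odd_family (W :\: S1) P1.
  apply/odd_familyP; split.
  - by apply: trivIsetU => //; apply: trivIsetD.
  - by move=> D; rewrite !inE => /orP[/oP'|/andP[_ /oP]].
  - move=> D; rewrite !inE => /orP[/cP'|/andP[DC DP]].
      by rewrite CS1 WS1; apply: closed_in_trans; apply: cP.
    have [DWS HD] := closed_inP _ _ (cP D DP).
    apply/closed_inP; split.
      rewrite WS1 subsetI DWS /= -disjoints_subset disjoint_sym.
      apply: (disjointWl xS'C); rewrite disjoint_sym.
      exact: (trivIsetP tP).
    by move=> y z yD; rewrite WS1 inE => /andP[zW _]; apply: HD.
have cP1 : #|P1| = #|P'| + #|P|.-1.
  rewrite /P1 cardsU; have -> : P' :&: (P :\ C) = set0.
    apply/setP=> D; rewrite !inE; apply/negP=> /and3P[DP' DC DP].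
    have : D != set0 by rewrite -card_gt0 odd_gt0 ?oP.
    case/set0Pn=> y yD; have : y \in cover P' by apply/bigcupP; exists D.
    move/(disjointFr dPP)/negP; apply; apply/bigcupP; exists D => //.
    by rewrite !inE DC.
  by rewrite cards0 subn0 (cardsD1 C P) CP.
have Pgt0 : 0 < #|P| by rewrite card_gt0; apply/set0Pn; exists C.
have leP1 := tW S1W fP1.
have eP1 : #|P1| = #|S1| by move: leP1 Pgt0 ltP'; rewrite cP1 cS1 cPS; clear; lia.
suff /max_S : tight W S1 P1 by rewrite cS1; clear; lia.
by rewrite /tight S1W fP1 eP1 /=.
Qed.

(** Hall's condition for the members of [P] and their neighbours in [S] is Tutte's condition in
    disguise: a subfamily with neighbourhood [N] in [S] is an odd family of [W :\: N]. Equal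
    cardinalities make the injection onto. *)
Lemma max_tight_representatives (x0 : T) : exists f : {set T} -> T,
  [/\ {in P, forall C, f C \in S}, {in P &, injective f},
      f @: P = S & {in P, forall C, exists2 x, x \in C & e (f C) x}].
Proof.
case/and3P: tight_SP => SW fP /eqP cPS.
case/odd_familyP: (fP) => tP oP cP.
pose F C := [set s in S | [exists x in C, e s x]].
have [Y YP|f [fF finj]] := hall x0 (F := F) (X := P).
  set N := \bigcup_(a in Y) F a.
  have NS : N \subset S.
    by apply/bigcupsP=> C _; apply/subsetP=> s; rewrite inE => /andP[].
  apply: tW; first exact: subset_trans SW.
  apply/odd_familyP; split.
  - exact: trivIsetS tP.
  - by move=> C /(subsetP YP)/oP.
  move=> C CY; have [CWS HC] := closed_inP _ _ (cP C (subsetP YP _ CY)).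
  apply/closed_inP; split; first by apply: subset_trans CWS _; apply: setDS.
  move=> x y xC; rewrite inE => /andP[yN yW] yC.
  have [yS|yS] := boolP (y \in S); last by apply: HC; rewrite // inE yS.
  apply: contra yN => exy; apply/bigcupP; exists C => //; rewrite inE yS.
  by apply/exists_inP; exists x; rewrite // e_sym.
have fS C : C \in P -> f C \in S by move/fF; rewrite inE => /andP[].
exists f; split=> //.
  apply/eqP; rewrite eqEcard card_in_imset // cPS leqnn andbT.
  by apply/subsetP=> _ /imsetP[C /fS ? ->].
by move=> C /fF; rewrite inE => /andP[_ /exists_inP].
Qed.

End MaximalTight.

(** Strong induction on [#|W|]: a maximum tight [S] is matched to one vertex in each member of [P],
    and what remains of each member is matched by induction. *)
Lemma tutte W : tutte_condition W -> exists mate, matching_on W mate.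
Proof.
have [n] := ubnP #|W|; elim: n => // n IHn in W *; rewrite ltnS => leWn tW.
have [->|[x0 _]] := set_0Vmem W; first by exists id => x; rewrite inE.
have t0 : tight W set0 set0.
  rewrite /tight sub0set !cards0 eqxx andbT; apply/odd_familyP.
  by split=> [|C|C]; rewrite ?inE // /trivIset /cover !big_set0 cards0.
pose good (q : {set T} * {set {set T}}) := tight W q.1 q.2.
have t0' : good (set0, set0) by [].
case: (@arg_maxnP _ (set0, set0) good (fun q => #|q.1|) t0') => -[S P] tSP maxSP.
rewrite /good /= in tSP maxSP.
have maxS S' P' : tight W S' P' -> #|S'| <= #|S| by apply: (maxSP (S', P')).
have cov := max_tight_cover tW tSP maxS.
have [f [fS finj fim fe]] := max_tight_representatives tW tSP x0.
have mem := max_tight_member tW tSP maxS.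
case/and3P: tSP => SW /odd_familyP[tP oP cP] _.
have CWS C x : C \in P -> x \in C -> (x \in W) * (x \in S = false).
  move=> CP xC; have [/subsetP/(_ x xC) + _] := closed_inP _ _ (cP C CP).
  by rewrite inE => /andP[/negbTE -> ->].
(* Finite choice asks for a value at every set; off [P] it is arbitrary, here and for [mu] and [g]
   below. *)
have [v vP] : exists v, forall C : {set T}, C \in P -> v C \in C /\ e (f C) (v C).
  apply: (@fin_all_exists _ (fun=> T) (fun C y => C \in P -> y \in C /\ e (f C) y)) => C.
  have [CP|_] := boolP (C \in P); last by exists (f C).
  by have [x xC ex] := fe C CP; exists x.
have [mu muP] : exists mu : {set T} -> T -> T, forall C, C \in P ->
    matching_on (C :\ v C) (mu C).
  apply: (@fin_all_exists _ (fun=> T -> T)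
    (fun C mate => C \in P -> matching_on (C :\ v C) mate)) => C.
  have [CP|_] := boolP (C \in P); last by exists id.
  have [vC _] := vP C CP.
  have [||mu H] := IHn (C :\ v C); last by exists mu.
    apply: leq_trans leWn.
    apply: leq_trans (_ : #|C| <= _); first by rewrite (cardsD1 (v C) C) vC.
    by apply/subset_leq_card/subsetP=> x xC; rewrite (CWS C x).
  exact: mem.
have [g gP] : exists g : T -> {set T}, forall s, s \in S -> g s \in P /\ f (g s) = s.
  apply: (@fin_all_exists _ (fun=> {set T})
    (fun s C => s \in S -> C \in P /\ f C = s)) => s.
  have [sS|_] := boolP (s \in S); last by exists set0.
  by move: sS; rewrite -fim => /imsetP[C CP ->]; exists C.
have gf C : C \in P -> g (f C) = C.
  by move=> CP; have [gP' fg] := gP _ (fS C CP); apply: finj.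
(* As [g] inverts [f], this swaps [f C] with [v C] and follows [mu C] on the rest of [C]. *)
pose mate x := if x \in S then v (g x) else
  let C := pblock P x in if x == v C then f C else mu C x.
have mateS x : x \in S -> mate x = v (g x) by rewrite /mate => ->.
have mateC C x : C \in P -> x \in C -> mate x = if x == v C then f C else mu C x.
  by move=> CP xC; rewrite /mate (CWS C x) // (def_pblock tP CP xC).
exists mate => x xW; have [xS|xS] := boolP (x \in S).
  have [gxP fgx] := gP x xS; have [vC ev] := vP _ gxP; rewrite mateS //.
  have [vW vS] := CWS _ _ gxP vC.
  rewrite (mateC (g x)) // eqxx fgx; split=> //; last by rewrite -{1}fgx.
  by apply: contraTneq xS => <-; rewrite vS.
have : x \in cover P by rewrite cov inE xS.
case/bigcupP=> C CP xC; have [vC ev] := vP C CP; rewrite (mateC C) //.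
case: eqP => [->|/eqP xv].
  split; first by rewrite (subsetP SW) ?fS.
  - by rewrite mateS ?fS // gf.
  - by apply: contraTneq (fS C CP) => ->; rewrite (CWS C).
  - by rewrite e_sym.
have xCv : x \in C :\ v C by rewrite !inE xv.
have [] := muP C CP x xCv; rewrite !inE => /andP[muv muC] mumu mux emu.
split=> //; first by rewrite (CWS C).
by rewrite (mateC C) // (negbTE muv).
Qed.

End Tutte.

(** * Counting by sums of indicators *)

Lemma sum_eq_mem (T : finType) (C : {set T}) x : \sum_(v in C) (x == v) = (x \in C).
Proof.
have [xC|xC] := boolP (x \in C).
  rewrite (bigD1 x) //= eqxx big1 ?addn0 // => v /andP[_ vx].
  by rewrite eq_sym (negbTE vx).
by apply: big1 => v vC; case: eqP xC => // ->; rewrite vC.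
Qed.

Lemma trivIset_sum_mem (T : finType) (P : {set {set T}}) x :
  trivIset P -> \sum_(C in P) (x \in C) <= 1.
Proof.
move=> tP; have [/exists_inP[C CP xC]|noC] := boolP [exists C in P, x \in C].
  rewrite (bigD1 C) //= xC big1 // => D /andP[DP DC].
  by case: (boolP (x \in D)) DC => // xD; rewrite (trivIset_eq tP DP CP xD xC) eqxx.
rewrite big1 // => C CP; case: (boolP (x \in C)) noC => // xC /negP[].
by apply/exists_inP; exists C.
Qed.

Lemma card_sum (T : finType) (p : pred T) : #|[set x | p x]| = \sum_x p x.
Proof. by rewrite -sum1dep_card [LHS]big_mkcond; apply: eq_bigr => x _; case: (p x). Qed.

(** * Petersen's theorem for cubic bridgeless graphs *)

Section Petersen.

Variable G : mgraph.
Hypotheses (G_cubic : cubic G) (G_bridgeless : bridgeless G).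
Implicit Types (e : edge G) (v x y : vertex G) (C S : {set vertex G}) (M : {set edge G}).

Lemma sum_ends C : \sum_e ((src e \in C) + (tgt e \in C)) = 3 * #|C|.
Proof.
rewrite mulnC -sum_nat_const; under [RHS]eq_bigr => v _ do rewrite -(G_cubic v).
rewrite /degree big_split [RHS]big_split /=.
by congr (_ + _); under [RHS]eq_bigr => v _ do rewrite card_sum;
  rewrite exchange_big; apply: eq_bigr => e _; rewrite sum_eq_mem.
Qed.

Definition boundary C : {set edge G} := [set e | (src e \in C) (+) (tgt e \in C)].

Definition inside C : {set edge G} := [set e | (src e \in C) && (tgt e \in C)].

Lemma card_boundary C : #|boundary C| + 2 * #|inside C| = 3 * #|C|.
Proof.
rewrite -sum_ends !card_sum big_distrr -big_split; apply: eq_bigr => e _ /=.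
by case: (src e \in C); case: (tgt e \in C).
Qed.

(** A sole boundary edge would be a bridge: without it no walk leaves [C], yet its two ends must
    stay connected. *)
Lemma card_boundary_neq1 C : #|boundary C| != 1.
Proof.
apply/negP=> /cards1P[e bC].
have [_ H] := G_bridgeless (src e).
have /(H (boundary C)) : #|boundary C| < 2 by rewrite bC cards1.
move/(_ (src e) (tgt e)); rewrite !inE connect0 => /(_ isT).
rewrite connect1; last by apply/exists_inP; exists e; rewrite ?inE ?eqxx.
move=> /(_ isT) con; have : e \in boundary C by rewrite bC inE.
rewrite inE (closed_connect _ con) ?addbb // => x y.
case/exists_inP=> f; rewrite !inE => fC.
by case/orP=> /andP[/eqP <- /eqP <-]; move: fC; case: (src f \in C); case: (tgt f \in C).
Qed.

(** By [card_boundary] the boundary has the parity of [C], and it is not a single edge. *)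
Lemma odd_boundary C : odd #|C| -> 3 <= #|boundary C|.
Proof. by have := card_boundary C; have := card_boundary_neq1 C; lia. Qed.

(** A loop uses two of the three edge ends at its vertex, so the third would belong to a bridge. *)
Lemma no_loop e : src e != tgt e.
Proof.
apply/eqP=> loop.
have := card_boundary [set src e]; have := card_boundary_neq1 [set src e].
have : 0 < #|inside [set src e]|.
  by rewrite card_gt0; apply/set0Pn; exists e; rewrite !inE -loop eqxx.
by rewrite cards1; lia.
Qed.

Lemma adj_sym : symmetric (@adj G setT).
Proof. by move=> x y; apply: eq_existsb => e; rewrite orbC. Qed.

(** Each member of the family sends at least three edges out, all of them into [S], while [S] has
    only [3 * #|S|] edge ends to receive them. *)
Lemma petersen_tutte_condition : tutte_condition (@adj G setT) setT.
Proof.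
move=> S P _ /odd_familyP[tP oP cP].
rewrite -(leq_pmul2l (isT : 0 < 3)) -(sum_ends S) mulnC -sum_nat_const.
apply: leq_trans (_ : \sum_(C in P) #|boundary C| <= _).
  by apply: leq_sum => C /oP; apply: odd_boundary.
apply: leq_trans (_ : \sum_(C in P) \sum_e
    ((src e \in C) * (tgt e \in S) + (tgt e \in C) * (src e \in S)) <= _).
  apply: leq_sum => C CP; rewrite card_sum; apply: leq_sum => e _.
  have [_ H] := closed_inP _ _ _ (cP C CP).
  case: (boolP (src e \in C)) => sC; case: (boolP (tgt e \in C)) => tC //=.
    case: (boolP (tgt e \in S)) => // tS.
    have := H _ (tgt e) sC; rewrite !inE tS tC => /(_ isT isT)/negP[].
    by apply/exists_inP; exists e; rewrite ?inE ?eqxx.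
  case: (boolP (src e \in S)) => // sS.
  have := H _ (src e) tC; rewrite !inE sS sC => /(_ isT isT)/negP[].
  by apply/exists_inP; exists e; rewrite ?inE ?eqxx ?orbT.
rewrite exchange_big; apply: leq_sum => e _ /=.
(* The members are disjoint, so each end of an edge lies in at most one of them. *)
rewrite big_split -!big_distrl /= addnC.
by apply: leq_add; rewrite -[leqRHS]mul1n leq_mul2r trivIset_sum_mem ?orbT.
Qed.

Theorem petersen : exists M, perfect_matching M.
Proof.
have [mate mateP] := tutte adj_sym petersen_tutte_condition.
pose joins v e := (src e == v) && (tgt e == mate v) || (src e == mate v) && (tgt e == v).
(* The choice among parallel edges depends only on the unordered pair of [v] and [mate v], so both
   vertices pick the same edge. *)
pose medge v := [pick e | joins v e].
have mateK v : mate (mate v) = v by case: (mateP v); rewrite ?inE.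
have mate_neq v : mate v != v by case: (mateP v); rewrite ?inE.
have medge_mate v : medge (mate v) = medge v.
  by apply: eq_pick => e; rewrite /joins mateK orbC.
have medgeE v : exists2 e, medge v = Some e & joins v e.
  rewrite /medge; case: pickP => [e je|no]; first by exists e.
  have [_ _ _ /exists_inP[e _ je]] := mateP v (in_setT v).
  by have := no e; rewrite /joins je.
exists [set e | medge (src e) == Some e]; apply/forallP=> v; apply/cards1P.
have [e ve jve] := medgeE v; exists e; apply/setP=> f; rewrite !inE /incident.
apply/andP/eqP => [[/eqP fM /orP[/eqP fv|/eqP fv]]|->].
- by move: fM; rewrite fv ve => -[].
- have [g] := medgeE (src f); rewrite fM => -[<-] /orP[/andP[_ /eqP fm]|].
    by move: fM; rewrite -medge_mate -fm fv ve => -[].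
  by move=> /andP[/eqP E _]; have := mate_neq (src f); rewrite -E eqxx.
- case/orP: jve => /andP[/eqP sv /eqP tv]; rewrite sv tv ?medge_mate ve !eqxx //.
  by rewrite orbT.
Qed.

Definition star v : {set edge G} := [set e | incident e v].

Lemma card_star v : #|star v| = 3.
Proof.
rewrite -(G_cubic v) /degree -cardsUI.
rewrite (_ : _ :&: _ = set0) ?cards0 ?addn0; last first.
  apply/setP=> e; rewrite !inE; apply/negP=> /andP[/eqP sv /eqP tv].
  by have := no_loop e; rewrite sv tv eqxx.
by congr #|pred_of_set _|; apply/setP=> e; rewrite !inE.
Qed.

(** In the absence of loops every edge lies in exactly two stars. *)
Lemma sum_star (h : edge G -> nat) : \sum_v \sum_(e in star v) h e = 2 * \sum_e h e.
Proof.
under eq_bigr => v _ do rewrite big_mkcond.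
rewrite exchange_big big_distrr; apply: eq_bigr => e _ /=.
rewrite (bigD1 (src e)) //= (bigD1 (tgt e)) /=; last by rewrite eq_sym no_loop.
rewrite !inE /incident !eqxx orbT big1 ?addn0 ?mul2n ?addnn // => v /andP[vs vt].
by rewrite inE /incident ![_ == v]eq_sym (negbTE vs) (negbTE vt).
Qed.

End Petersen.

(** * The pairwise unions of four perfect matchings *)

(** An edge in [k] of the four matchings lies in 0, 3, 5, 6, 6 of the six pairwise unions for [k]
    from 0 to 4. *)
Definition pair_multiplicity (a b c d : bool) : nat :=
  (a || b) + (a || c) + (a || d) + (b || c) + (b || d) + (c || d).

(** For the multiplicities (2,1,1), (2,2,0), (3,1,0), (4,0,0) the two sides are 66 and 66, 51 and
    60, 51 and 54, 36 and 36. Equality in the first and last case determines the constants 15 and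
    7. *)
Lemma local_inequality (T : finType) (X A B C D : {set T}) :
  #|X| = 3 -> #|A :&: X| = 1 -> #|B :&: X| = 1 -> #|C :&: X| = 1 -> #|D :&: X| = 1 ->
  \sum_(x in X) (15 * (x \in A :|: B :|: C :|: D) + 7) <=
  6 * \sum_(x in X) pair_multiplicity (x \in A) (x \in B) (x \in C) (x \in D).
Proof.
have cE (Z : {set T}) : #|Z :&: X| = \sum_(x <- enum X) (x \in Z).
  rewrite -sum1_card big_enum /= [RHS]big_mkcond [LHS]big_mkcond; apply: eq_bigr => x _ /=.
  by rewrite inE; case: (x \in X); case: (x \in Z).
rewrite !cE -!big_enum /= cardE; case: (enum X) => [|x [|y [|z []]]] // _.
rewrite !big_cons !big_nil !inE /pair_multiplicity.
case: (x \in A); case: (y \in A); case: (z \in A) => //= _;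
case: (x \in B); case: (y \in B); case: (z \in B) => //= _;
case: (x \in C); case: (y \in C); case: (z \in C) => //= _;
case: (x \in D); case: (y \in D); case: (z \in D) => //= _.
Qed.

Lemma four_matchings (G : mgraph) (G_cubic : cubic G) (G_bridgeless : bridgeless G)
    (A B C D : {set edge G}) :
  perfect_matching A -> perfect_matching B -> perfect_matching C -> perfect_matching D ->
  15 * #|A :|: B :|: C :|: D| + 7 * #|edge G| <=
  6 * (#|A :|: B| + #|A :|: C| + #|A :|: D| + #|B :|: C| + #|B :|: D| + #|C :|: D|).
Proof.
move=> /forallP pA /forallP pB /forallP pC /forallP pD.
have cs (M : {set edge G}) v : #|[set e in M | incident e v]| == 1 -> #|M :&: star v| = 1.
  by move/eqP=> <-; congr #|pred_of_set _|; apply/setP=> e; rewrite !inE.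
(* Summing the local inequality over all vertices counts every edge twice. *)
rewrite -(leq_pmul2l (isT : 0 < 2)).
have cM (M : {set edge G}) : #|M| = \sum_e (e \in M) by rewrite -card_sum; congr #|pred_of_set _|; apply/setP=> e; rewrite inE.
apply: leq_trans (_ : \sum_v \sum_(e in star v)
    (15 * (e \in A :|: B :|: C :|: D) + 7) <= _).
  rewrite sum_star // leq_mul2l /= big_split -big_distrr -cM /=.
  by rewrite sum_nat_const [X in _ <= _ + X]mulnC.
apply: leq_trans (_ : 6 * \sum_v \sum_(e in star v)
    pair_multiplicity (e \in A) (e \in B) (e \in C) (e \in D) <= _).
  rewrite big_distrr; apply: leq_sum => v _; apply: local_inequality.
  - exact: card_star.
  - exact: cs.
  - exact: cs.
  - exact: cs.
  - exact: cs.
rewrite sum_star // mulnCA leq_mul2l leq_mul2l /= !cM -!big_split /=.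
by apply: leq_sum => e _; rewrite !inE.
Qed.

(** * From cardinalities to the ratios [m G t] *)

Local Open Scope ring_scope.

Lemma cover_le_m (G : mgraph) t (M : {ffun 'I_t -> {set edge G}}) :
  (forall i, perfect_matching (M i)) ->
  #|\bigcup_(i < t) M i|%:R / #|edge G|%:R <= m G t.
Proof.
move=> pM; rewrite ler_wpM2r ?invr_ge0 ?ler0n // ler_nat.
apply: (leq_bigmax_cond M); exact/forallP.
Qed.

(** The constant family at [M0] makes the range of the maximum nonempty, so the maximum is not the
    default 0 of an empty range. *)
Lemma m_attained (G : mgraph) t (M0 : {set edge G}) : perfect_matching M0 ->
  exists2 M : {ffun 'I_t -> {set edge G}}, forall i, perfect_matching (M i) &
  m G t = #|\bigcup_(i < t) M i|%:R / #|edge G|%:R.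
Proof.
move=> pM0.
have [|M /forallP pM maxM] := @eq_bigmax_cond _
  [pred M : {ffun 'I_t -> {set edge G}} | [forall i, perfect_matching (M i)]]
  (fun M => #|\bigcup_(i < t) M i|).
  apply/card_gt0P; exists [ffun => M0]; rewrite inE.
  by apply/forallP=> i; rewrite ffunE.
by exists M => //; rewrite /m -maxM.
Qed.

Theorem theorem12 (G : mgraph) (G_nonempty : (0 < #|vertex G|)%N)
    (G_cubic : cubic G) (G_bridgeless : bridgeless G) :
  m G 2 >= 5 / 12 * m G 4 + 7 / 36.
Proof.
have [M0 pM0] := petersen G_cubic G_bridgeless.
(* In the empty graph both ratios are 0 by the convention on division by zero, and the bound fails;
   a vertex provides three edges. *)
have E0 : (0 < #|edge G|)%N.
  case/card_gt0P: G_nonempty => v _; rewrite -cardsT.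
  by apply: leq_trans (subset_leq_card (subsetT (star v))); rewrite card_star.
have le2 (A B : {set edge G}) : perfect_matching A -> perfect_matching B ->
    #|A :|: B|%:R <= m G 2 * #|edge G|%:R.
  move=> pA pB; rewrite -ler_pdivrMr ?ltr0n //.
  have := @cover_le_m G 2 [ffun i : 'I_2 => if i == ord0 then A else B].
  by rewrite big_ord_recl big_ord1 !ffunE /=; apply=> i; rewrite ffunE; case: ifP.
have [M pM m4E] := m_attained 4 pM0.
have {m4E} : m G 4 * #|edge G|%:R = #|\bigcup_(i < 4) M i|%:R.
  by rewrite m4E divfK // pnatr_eq0 -lt0n.
rewrite !big_ord_recl big_ord0 setU0 !setUA.
move: (pM ord0) (pM (lift ord0 ord0)) (pM (lift ord0 (lift ord0 ord0)))
  (pM (lift ord0 (lift ord0 (lift ord0 ord0)))).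
move: (M _) (M _) (M _) (M _) => A B C D pA pB pC pD m4E.
have := four_matchings G_cubic G_bridgeless pA pB pC pD.
rewrite -(ler_nat rat) !(natrD, natrM) => ineq.
have E0' : (0 : rat) < #|edge G|%:R by rewrite ltr0n.
rewrite -(ler_pM2r E0').
(* Bounding all six unions by [m G 2] gives [15 * m G 4 + 7 <= 36 * m G 2] after division by the
   number of edges; 15/36 is 5/12. *)
have := le2 _ _ pA pB; have := le2 _ _ pA pC; have := le2 _ _ pA pD.
have := le2 _ _ pB pC; have := le2 _ _ pB pD; have := le2 _ _ pC pD.
by lra.
Qed.
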